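(* Let $K$ be a finite set of positive integers with at least two elements, let $g=\min(K)$ and let $G$ be any additive group of order $g$. Then there is a positive integer $\lambda$ such that for every integer $v>1$ all of whose components $q$ satisfy $q\equiv\lambda+1\pmod{2\lambda}$ and $q>Q(\lambda,\max(K))$, there exists an S$(2,K,gv)$ which is harmonious under $G\times\mathbb F_v$.
   Context: For positive integers $e,n$ let $U=\sum_{h=1}^n\binom nh(e-1)^h(h-1)$ and $Q(e,n)=\frac14\bigl(U+\sqrt{U^2+4ne^{n-1}}\bigr)^2$. The components of an integer $v$ are the maximal prime power divisors of $v$; $\mathbb F_v$ denotes the ring which is the direct product of the finite fields whose orders are the components of $v$ (its additive group is used). A linear space S$(2,K,v)$: $v$ points, blocks with sizes in $K$ (every element of $K$ occurring), every pair of points in exactly one block; a resolution partitions the blocks into parallel classes each partitioning the points. A linear space is harmonious under an additive group $\Gamma$ if it has point set $\Gamma$ and a resolution such that the group of translations of $\Gamma$ is an automorphism group of the resolved linear space acting sharply transitively on points and transitively on parallel classes. *)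

(* Defs.v *)
From HB Require Import structures.
From mathcomp Require Import all_boot all_order all_algebra all_fingroup.
From mathcomp Require Import finmap reals.

Set Implicit Arguments.
Unset Strict Implicit.
Unset Printing Implicit Defensive.

Import Order.TTheory GRing.Theory Num.Theory.

Local Open Scope nat_scope.

Definition fset_max (K : {fset nat}) : nat := \max_(k <- K) k.

(* [minn] has no neutral element, so the fold starts from the maximum of [K];
   this is the least element of [K] whenever [K] is nonempty. *)
Definition fset_min (K : {fset nat}) : nat :=
  \big[minn/fset_max K]_(k <- K) k.

(* The truncated subtractions are exact for [e >= 1], since [h >= 1]. *)
Definition boundU (e n : nat) : nat :=
  \sum_(1 <= h < n.+1) 'C(n, h) * (e - 1) ^ h * (h - 1).

Definition boundQ (R : realType) (e n : nat) : R :=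
  (4%:R^-1 * ((boundU e n)%:R
     + Num.sqrt ((boundU e n)%:R ^+ 2 + (4 * n * e ^ (n - 1))%:R)) ^+ 2)%R.

Definition components (v : nat) : seq nat :=
  [seq p ^ logn p v | p <- primes v].

Definition component_fields (v : nat)
    (F : 'I_(size (components v)) -> finFieldType) : Prop :=
  forall i, #|F i| = nth 0 (components v) i.

(* For a [finFieldType], the canonical [finGroupType] structure is the one for
   addition, so this is the additive group of the ring [\prod_i F i]. *)
Definition prod_additive (v : nat)
    (F : 'I_(size (components v)) -> finFieldType) : finGroupType :=
  {dffun forall i, F i}.

(* A sequence of sets stands for a multiset. A block with at least two points
   cannot be repeated, by the last clause, but if [1 \in K] a block of size 1
   may be. *)
Definition linear_space (T : finType) (K : {fset nat}) (v : nat)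
    (blocks : seq {set T}) : Prop :=
  [/\ #|T| = v,
      forall B, B \in blocks -> #|B| \in K,
      forall k, k \in K -> exists2 B, B \in blocks & #|B| = k
    & forall x y : T, x != y ->
        count (fun B : {set T} => (x \in B) && (y \in B)) blocks = 1].

(* The members of [classes] jointly list every block of the multiset [blocks]
   with its multiplicity. *)
Definition is_resolution (T : finType) (blocks : seq {set T})
    (classes : seq {set {set T}}) : Prop :=
  (forall P, P \in classes -> partition P [set: T]) /\
  perm_eq (flatten [seq enum P | P : {set {set T}} <- classes]) blocks.

Section Translations.

Variable gT : finGroupType.

(* The translation [x |-> x + c]; the group law is written multiplicatively
   and need not be commutative. *)
Definition translate (c x : gT) : gT := (x * c)%g.

Definition translate_block (c : gT) (B : {set gT}) : {set gT} :=
  [set translate c x | x in B].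

Definition translate_class (c : gT) (P : {set {set gT}}) : {set {set gT}} :=
  [set translate_block c B | B in P].

Definition is_automorphism (blocks : seq {set gT})
    (classes : seq {set {set gT}}) (c : gT) : Prop :=
  perm_eq [seq translate_block c B | B <- blocks] blocks /\
  perm_eq [seq translate_class c P | P <- classes] classes.

Definition harmonious (blocks : seq {set gT}) : Prop :=
  exists classes : seq {set {set gT}},
    [/\ is_resolution blocks classes,
        forall c, is_automorphism blocks classes c,
        forall x y, exists! c, translate c x = y
      & forall P P', P \in classes -> P' \in classes ->
          exists c, translate_class c P = P'].

End Translations.

(* Main.v *)
(* Blocks live on G x F_v, and the base parallel class is G-invariant: it
   consists of the coset G x {0} and of the G-translates of blocks
   {(a_j, x_j m) : j}, where (a_j) runs over a fixed pattern of base blocks with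
   entries in G and m over a set of multipliers.  The pattern uses, for each
   size k in a list with sum k (k - 1) = g sum k, all maps from the positions to
   G; then there are lambda points, and each element of G is a difference of
   exactly lambda ordered pairs.  The translates by F_v resolve a linear space
   as soon as, in each component F_q, the points x_j, and the differences
   x_i - x_j of the pairs with a given G-difference, represent the cosets of the
   group of lambda-th powers.

   Choosing such x_j amounts to finding a tournament with prescribed colours,
   the colour of x being x^((q-1)/lambda).  The bound Q comes from Weil's theorem,
   but here lambda is ours to choose: a second moment argument shows that the
   colour classes are pseudorandom, and greedy embedding then succeeds for
   q of order lambda^(2 max K), which is below Q when lambda is large and
   max K > 2.  When max K = 2 the blocks {m, -m} do. *)

Require Import Defs.
From HB Require Import structures.
From mathcomp Require Import all_boot all_order all_algebra all_fingroup.
From mathcomp Require Import cyclic finfield finmap reals zify ring lra.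

Import Order.TTheory GRing.Theory Num.Theory.

Local Open Scope nat_scope.

Set Implicit Arguments.
Unset Strict Implicit.
Unset Printing Implicit Defensive.

(** * Power-residue colours in a finite field: second moments and greedy embedding *)

Section PowerResidues.

Variables (F : finFieldType) (e f : nat).
Hypotheses (cardF : #|F| = (e * f).+1) (e_gt0 : 0 < e) (f_gt0 : 0 < f).

Local Notation mu := [set z : F | (z ^+ e == 1)%R].

(** Since [#|F| - 1 = e * f], the map [x ^+ f] on nonzero elements takes values in the [e]-th roots
    of unity, and its fibres are the cosets of the group of [e]-th powers. Its value at [y - x] is
    the colour of the pair, so this is a degree of [x] into [V] in one colour. *)
Definition residue_degree (V : {set F}) (x z : F) : nat :=
  #|[set y in V | ((y - x) ^+ f == z)%R]|.

Lemma card_unity_set_le m : 0 < m -> #|[set z : F | (z ^+ m == 1)%R]| <= m.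
Proof.
move=> m_gt0; rewrite cardE; apply: (max_unity_roots m_gt0); last exact: enum_uniq.
apply/allP => z; rewrite mem_enum inE => /eqP zm; by apply/unity_rootP.
Qed.

Lemma expf_class (x : F) : x != 0%R -> (x ^+ f)%R \in mu.
Proof.
move=> x0; rewrite inE -exprM mulnC; apply/eqP.
have := expf_card x; rewrite cardF exprS => h.
by apply: (mulfI x0); rewrite h mulr1.
Qed.

Lemma mu_neq0 (z : F) : z \in mu -> z != 0%R.
Proof.
rewrite inE; apply: contraL => /eqP->.
by rewrite expr0n; case: e e_gt0 => //= *; rewrite eq_sym oner_eq0.
Qed.

Lemma expf0_class (z : F) : z \in mu -> (0 ^+ f == z)%R = false.
Proof.
by move=> /mu_neq0 /negbTE z0; rewrite expr0n eqn0Ngt f_gt0 eq_sym.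
Qed.

(** The quotient [(y - x) / (y' - x)] is a Moebius function of [x], hence injective. On the set in
    question its values are [f]-th roots of unity other than 1, which leaves at most [f - 1] of
    them. *)
Lemma card_common_class (y y' : F) : y != y' ->
  #|[set x : F | [&& x != y, x != y' & (y - x) ^+ f == (y' - x) ^+ f]%R]| < f.
Proof.
move=> yy'.
set A := [set x | _].
have Dy x : x \in A -> (y' - x != 0)%R.
  by rewrite inE => /and3P[_ ? _]; rewrite subr_eq0 eq_sym.
pose u (x : F) := ((y - x) / (y' - x))%R.
have u_inj : {in A &, injective u}.
  move=> x1 x2 /Dy d1 /Dy d2 /eqP; rewrite /u eqr_div // => /eqP E.
  have : ((y - y') * (x1 - x2) = 0)%R.
    by transitivity ((y - x1) * (y' - x2) - (y - x2) * (y' - x1))%R; [ring | rewrite E subrr].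
  by move/eqP; rewrite mulf_eq0 !subr_eq0 (negbTE yy') => /eqP.
have sub : u @: A \subset [set z : F | (z ^+ f == 1)%R] :\ 1%R.
  apply/subsetP=> _ /imsetP[x xA ->]; have dx := Dy _ xA.
  move: xA; rewrite !inE => /and3P[_ _ /eqP E].
  rewrite /u expr_div_n E divff ?expf_neq0 // eqxx andbT.
  apply: contra yy' => /eqP E1.
  have : (y - x = y' - x)%R by rewrite -[LHS](divfK dx) E1 mul1r.
  by move/addIr ->.
rewrite -(card_in_imset u_inj).
apply: leq_ltn_trans (subset_leq_card sub) _.
have : 1%R \in [set z : F | (z ^+ f == 1)%R] by rewrite inE expr1n.
move=> h1; have := card_unity_set_le f_gt0.
by rewrite (cardsD1 1%R) h1 add1n.
Qed.

Lemma residue_degreeE V x z :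
  residue_degree V x z = \sum_(y in V) (((y - x) ^+ f)%R == z).
Proof.
rewrite /residue_degree -sum1_card big_mkcond [RHS]big_mkcond /=.
by apply: eq_bigr => y _; rewrite inE; case: (y \in V) => //=; case: eqP.
Qed.

Lemma sum_residue_degree (V : {set F}) :
  \sum_x \sum_(z in mu) residue_degree V x z = #|V| * (e * f).
Proof.
under eq_bigr do under eq_bigr do rewrite residue_degreeE.
under eq_bigr do rewrite exchange_big.
rewrite exchange_big /= -sum_nat_const; apply: eq_bigr => y _.
have E x : \sum_(z in mu) (((y - x) ^+ f)%R == z) = (x != y).
  have [-> | xy] := eqVneq x y.
    by rewrite big1 // => z zmu; rewrite subrr expf0_class.
  have d : (y - x != 0)%R by rewrite subr_eq0 eq_sym.
  rewrite (bigD1 ((y - x) ^+ f)%R) ?expf_class //= eqxx big1 // => z /andP[_].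
  by rewrite eq_sym => /negbTE ->.
under eq_bigr do rewrite E.
have := cardC (pred1 y); rewrite card1 cardF => -[<-].
by rewrite -sum1_card [RHS]big_mkcond; apply: eq_bigr => x _; rewrite !inE; case: eqP.
Qed.

(** The squares count pairs [y], [y'] in [V] that have the same colour from [x]. A diagonal pair
    contributes [e * f] vertices [x], and any other pair at most [f - 1]. *)
Lemma sum_sqr_residue_degree (V : {set F}) :
  \sum_x \sum_(z in mu) residue_degree V x z ^ 2 <=
  #|V| * (e * f) + #|V| * ((#|V| - 1) * (f - 1)).
Proof.
have E x z : residue_degree V x z ^ 2 = \sum_(y in V) \sum_(y' in V)
    (((y - x) ^+ f)%R == z) * (((y' - x) ^+ f)%R == z).
  by rewrite residue_degreeE -mulnn big_distrl; apply: eq_bigr => y _; rewrite big_distrr.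
under eq_bigr do under eq_bigr do rewrite E.
under eq_bigr do rewrite exchange_big.
rewrite exchange_big /= -mulnDr -sum_nat_const; apply: leq_sum => y yV.
under eq_bigr do rewrite exchange_big.
rewrite exchange_big /= (bigD1 y) //=; apply: leq_add.
  under eq_bigr do under eq_bigr do rewrite mulnb andbb.
  have := sum_residue_degree [set y]; rewrite cards1 mul1n => <-.
  by apply: leq_sum => x _; apply: leq_sum => z _; rewrite residue_degreeE big_set1.
have -> : #|V| - 1 = #|V :\ y| by rewrite (cardsD1 y V) yV; lia.
rewrite -sum_nat_const [leqRHS](eq_bigl (fun i => (i \in V) && (i != y))); last first.
  by move=> i; rewrite !inE andbC.
apply: leq_sum => y' /andP[y'V y'y].
have := card_common_class y'y => h.
have {}h : #|[set x : F | [&& x != y', x != y & (y' - x) ^+ f == (y - x) ^+ f]%R]| <= f - 1 by lia.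
apply: leq_trans h; rewrite -sum1_card big_mkcond /= [leqRHS]big_mkcond /=; apply: leq_sum => x _.
rewrite inE.
have [-> | xy'] := eqVneq x y'; rewrite /=.
  by rewrite big1 // => z zmu; rewrite subrr expf0_class // ?muln0 ?mul0n.
have [-> | xy] := eqVneq x y; rewrite /=.
  by rewrite big1 // => z zmu; rewrite subrr expf0_class // ?muln0 ?mul0n.
rewrite (bigD1 ((y' - x) ^+ f)%R) /=; last by rewrite expf_class // subr_eq0 eq_sym.
rewrite eqxx big1 ?addn0; last first.
  by move=> z /andP[_]; rewrite eq_sym => /negbTE ->; rewrite muln0.
by rewrite muln1 eq_sym; case: eqP.
Qed.

(* Summing over all colours replaces cyclotomic numbers, which would call for
   character sums, by the plain count in [card_common_class]. *)
Lemma residue_degree_variance (V : {set F}) : 0 < #|V| ->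
  (\sum_x \sum_(z in mu) (e%:R * (residue_degree V x z)%:R - #|V|%:R) ^+ 2
   < (e ^ 2 * #|F| * #|V|)%:R :> int)%R.
Proof.
move=> V_gt0.
have S1 := sum_residue_degree V; have S2 := sum_sqr_residue_degree V.
have Mu := card_unity_set_le e_gt0.
set d := residue_degree V in S1 S2 *; set N := #|V| in V_gt0 S1 S2 *.
have -> : (\sum_x \sum_(z in mu) (e%:R * (d x z)%:R - N%:R) ^+ 2 =
    (e ^ 2 * \sum_x \sum_(z in mu) d x z ^ 2)%:R
    - 2%:R * (e * N * \sum_x \sum_(z in mu) d x z)%:R
    + (#|F| * #|mu| * N ^ 2)%:R :> int)%R.
  rewrite !natrM !natr_sum. rewrite mulr_sumr [X in (2%:R * X)%R]mulr_sumr mulr_sumr -sumrB.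
  have -> : (#|F|%:R * #|mu|%:R * (N%:R * N%:R) = \sum_(x : F) #|mu|%:R * (N%:R * N%:R) :> int)%R.
    by rewrite sumr_const -mulrA -[in RHS](mulr_natl _ #|F|).
  rewrite -big_split /=; apply: eq_bigr => x _.
  rewrite !natr_sum mulr_sumr [X in (2%:R * X)%R]mulr_sumr mulr_sumr -sumrB.
  have -> : (#|mu|%:R * (N%:R * N%:R) = \sum_(z in mu) (N%:R * N%:R) :> int)%R.
    by rewrite sumr_const -[in RHS](mulr_natl _ #|mu|).
  rewrite -big_split /=; apply: eq_bigr => z _.
  by rewrite !natrX; ring.
rewrite S1 cardF in Mu *.
move: S2 Mu; set A := \sum_x _; set m := #|_| => S2 Mu; clearbody A N m; clear S1.
(* An upper bound for [#|mu|] is enough, as its term enters with a plus sign. *)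
have M2 : (e * f).+1 * m * N ^ 2 <= (e * f).+1 * e * N ^ 2 by rewrite leq_mul2r leq_mul2l Mu !orbT.
have M3 : e ^ 2 * A <= e ^ 2 * (N * (e * f) + N * ((N - 1) * (f - 1))) by rewrite leq_mul2l S2 orbT.
clear S2; move: M2 M3; rewrite -!(ler_nat int).
set X := ((_ * m * _)%:R)%R; set Y := ((_ * A)%:R)%R.
rewrite !(natrM, natrD, natrX) !(natrB, natrM, natrD, natrX) // => M2 M3.
rewrite -?natr1 ?natrM in M2 M3 *.
have n0 : (0 < N%:R :> int)%R by rewrite ltr0n.
have k0 : (0 < f%:R :> int)%R by rewrite ltr0n.
have a0 : (0 <= e%:R - 1 :> int)%R by rewrite subr_ge0 ler1n.
move: (N%:R)%R (f%:R)%R (e%:R)%R n0 k0 a0 X Y M2 M3 => n' f' e' n0 k0 a0 X Y M2 M3.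
have e'0 : (0 < e')%R by lia.
(* After the substitutions, the right side exceeds the left by at least
   [e ^ 2 * f * N + e * (e - 1) * N ^ 2]. *)
have h1 : (0 < e' * e' * f' * n')%R by rewrite !mulr_gt0.
have h2 : (0 <= n' * n' * e' * (e' - 1))%R by rewrite !mulr_ge0 // ltW.
by nra.
Qed.

(** Chebyshev's inequality: each [x] of degree below [s] in colour [z] contributes at least
    [(#|V| - e * s) ^ 2] to the variance. *)
Lemma few_low_degree (V : {set F}) (z : F) s : z \in mu -> 0 < #|V| -> e * s <= #|V| ->
  #|[set x | residue_degree V x z < s]| * (#|V| - e * s) ^ 2 < e ^ 2 * #|F| * #|V|.
Proof.
move=> zmu V_gt0 sV; rewrite -(ltr_nat int).
apply: le_lt_trans (residue_degree_variance V_gt0).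
rewrite natrM -sum1_card natr_sum mulr_suml.
rewrite [leRHS](bigID (mem [set x | residue_degree V x z < s])) /=.
rewrite -[leLHS]addr0; apply: lerD; last first.
  by apply: sumr_ge0 => x _; apply: sumr_ge0 => w _; apply: sqr_ge0.
apply: ler_sum => x; rewrite inE => dx.
rewrite (bigD1 z) //= -[leLHS]addr0; apply: lerD; last first.
  by apply: sumr_ge0 => w _; apply: sqr_ge0.
rewrite mul1r natrX natrB // -[(_ - #|V|%:R)%R]opprB sqrrN -natrM.
have ds : e * residue_degree V x z <= e * s by rewrite leq_mul2l (ltnW dx) orbT.
rewrite ler_sqr ?nnegrE ?subr_ge0 ?ler_nat ?lerD2l ?lerN2 ?ler_nat //.
exact: leq_trans sV.
Qed.

(* Candidate sets of this size, for [m.+1] vertices still to be chosen, allow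
   the greedy choice to continue; [r] is an upper bound for [sqrt #|F|]. *)
Fixpoint threshold (r m : nat) : nat :=
  if m is m'.+1 then e * threshold r m' + m * e * r else 1.

(** The recursion unrolls to [e ^ m] plus [r] times the sum of [k * e ^ (m + 1 - k)] for [k] from 1
    to [m]. The summand [k = 1] is kept, and the others are at most [k * e ^ (m - 1)]. *)
Lemma threshold_le r m :
  threshold r m <= e ^ m + r * e ^ m + r * m ^ 2 * e ^ m.-1.
Proof.
elim: m => [|m IHm]; first by rewrite expn0.
have [-> | m_gt0] := posnP m; first by rewrite /= !expn1 expn0; lia.
rewrite [threshold _ _]/=.
apply: leq_trans (leq_add (leq_mul (leqnn e) IHm) (leqnn _)) _.
have e_le : e <= e ^ m by rewrite -[leqLHS]expn1 leq_pexp2l.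
have -> : e * (e ^ m + r * e ^ m + r * m ^ 2 * e ^ m.-1) =
   e ^ m.+1 + r * e ^ m.+1 + r * m ^ 2 * e ^ m.
  by rewrite -[in e ^ m.+1](prednK m_gt0) -[in e ^ m](prednK m_gt0) !expnS; lia.
by rewrite -addnA leq_add2l [m.+1.-1]/=; nia.
Qed.

Lemma residue_degreeS (V W : {set F}) x z :
  V \subset W -> residue_degree V x z <= residue_degree W x z.
Proof.
move=> /subsetP VW; apply/subset_leq_card/subsetP => y.
by rewrite !inE => /andP[/VW-> ->].
Qed.

(** Union bound: each of the [m.+1] conditions excludes at most a fraction [1 / m.+1] of [S - 1]
    vertices, and [V] has at least [S]. With [s = threshold r m], the number [S] is
    [threshold r m.+1]. *)
Lemma exists_high_degree (r s m : nat) (V : {set F}) (W : nat -> {set F}) (z : nat -> F) :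
    #|F| <= r ^ 2 ->
    e * s + m.+1 * e * r <= #|V| ->
    (forall i, i < m.+1 -> e * s + m.+1 * e * r <= #|W i|) ->
    (forall i, i < m.+1 -> z i \in mu) ->
  exists2 x, x \in V & forall i, i < m.+1 -> s <= residue_degree (W i) x (z i).
Proof.
move=> Fr; set S := e * s + _ => SV SW zmu.
have r_gt0 : 0 < r by move: Fr; rewrite cardF; case: r {S SV SW}.
have S_gt0 : 0 < S by rewrite /S addn_gt0 !muln_gt0 e_gt0 r_gt0 orbT.
pose B i := [set x | residue_degree (W i) x (z i) < s].
have cardB i : i < m.+1 -> #|B i| * m.+1 <= S.-1.
  (* Cutting [W i] down to exactly [S] elements fixes the deviation at [m.+1 * e * r]; degrees into
     the subset only decrease. *)
  move=> im; have /card_geqP[t [t_uniq t_size tW]] := SW i im.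
  pose W' : {set F} := [set x in t].
  have cardW' : #|W'| = S by rewrite cardsE (card_uniqP t_uniq).
  have W'W : W' \subset W i by apply/subsetP => x; rewrite inE => /tW.
  have := @few_low_degree W' (z i) s (zmu i im).
  rewrite cardW' => /(_ S_gt0 (leq_addr _ _)).
  have -> : S - e * s = m.+1 * e * r by rewrite /S addKn.
  move=> low.
  have BB : #|B i| <= #|[set x | residue_degree W' x (z i) < s]|.
    apply/subset_leq_card/subsetP => x; rewrite !inE.
    exact: leq_ltn_trans (residue_degreeS _ _ W'W).
  have : #|B i| * (m.+1 * e * r) ^ 2 < (e * r) ^ 2 * S.
    apply: leq_ltn_trans (leq_mul BB (leqnn _)) (leq_trans low _).
    by rewrite expnMn leq_mul2r leq_mul2l Fr !orbT.
  rewrite -mulnA expnMn mulnA mulnC ltn_pmul2l ?expn_gt0 ?muln_gt0 ?e_gt0 ?r_gt0 //.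
  by move: S_gt0; clearbody S; nia.
have sumB : \sum_(i < m.+1) #|B i| < S.
  have : \sum_(i < m.+1) #|B i| * m.+1 <= \sum_(i < m.+1) S.-1.
    by apply: leq_sum => i _; apply: cardB.
  rewrite -big_distrl sum_nat_const card_ord /= [leqLHS]mulnC leq_pmul2l //.
  by move: S_gt0; case: (S).
have [/existsP[x /andP[xV /forallP xB]] | none] :=
  boolP [exists x, (x \in V) && [forall i : 'I_m.+1, x \notin B i]].
  by exists x => // i im; have := xB (Ordinal im); rewrite inE -leqNgt.
have : #|V| <= \sum_(i < m.+1) #|B i|.
  under eq_bigr do rewrite -sum1_card big_mkcond.
  rewrite exchange_big -sum1_card big_mkcond; apply: leq_sum => x _.
  case: ifP => // xV; move: none; rewrite negb_exists => /forallP/(_ x).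
  rewrite xV negb_forall => /existsP[i]; rewrite negbK => xB.
  by rewrite (bigD1 i) //= xB.
by move=> /(leq_trans SV) /leq_ltn_trans /(_ sumB); rewrite ltnn.
Qed.

(** The vertex with the largest index is chosen first, with high degree in the prescribed colour
    into every other candidate set. Each of these is then replaced by the neighbourhood of the
    chosen vertex in that colour, and the induction goes on inside. *)
Lemma greedy_configuration (r m : nat) (V : nat -> {set F}) (z : nat -> nat -> F) :
    #|F| <= r ^ 2 ->
    (forall i, i <= m -> threshold r m <= #|V i|) ->
    (forall i j, z i j \in mu) ->
  exists x : nat -> F, (forall i, i <= m -> x i \in V i) /\
    forall i j, i < j <= m -> ((x i - x j) ^+ f)%R = z i j.
Proof.
move=> Fr; elim: m V => [|m IHm] V Vbig zmu.
  have /card_gt0P[x xV] := Vbig 0 (leqnn 0).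
  exists (fun=> x); split=> [i|i j]; first by rewrite leqn0 => /eqP->.
  by case: j => [|j]; rewrite ?ltn0 // andbF.
have [x0 x0V x0deg] := exists_high_degree Fr (Vbig m.+1 (leqnn _))
  (fun i im => Vbig i (ltnW im)) (fun i _ => zmu i m.+1).
pose V' i := [set y in V i | ((y - x0) ^+ f == z i m.+1)%R].
have [|x [xV' xz]] := IHm V' _ zmu; first by move=> i im; apply: x0deg.
exists (fun i => if i == m.+1 then x0 else x i); split=> [i|i j].
  rewrite leq_eqVlt; case: eqP => [-> // | _] /= im.
  by have := xV' i im; rewrite inE => /andP[].
case/andP=> ij; rewrite leq_eqVlt ltnS; case: eqP => [jm _ | _ /= jm].
  have im : i <= m by rewrite -ltnS -jm.
  rewrite ltn_eqF // jm; have := xV' i im.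
  by rewrite inE => /andP[_ /eqP].
by rewrite ltn_eqF; [apply: xz; rewrite ij | rewrite ltnS (leq_trans (ltnW ij))].
Qed.

(** At most [e] colours, with at most [f] elements each, have to cover [e * f] nonzero elements, so
    both bounds are attained. *)
Lemma card_mu_class :
  #|mu| = e /\ forall z : F, z \in mu -> #|[set x | x ^+ f == z]%R| = f.
Proof.
pose C z : {set F} := [set x | x ^+ f == z]%R.
have Cle z : z \in mu -> #|C z| <= f.
  move=> zmu; have [->|[x0 x0C]] := set_0Vmem (C z); first by rewrite cards0.
  have x00 : x0 != 0%R.
    by apply: contraTneq x0C => ->; rewrite inE expf0_class.
  apply: leq_trans (card_unity_set_le f_gt0).
  rewrite -(card_imset _ (mulIf (invr_neq0 x00))).
  apply/subset_leq_card/subsetP => _ /imsetP[x xC ->].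
  move: x0C xC; rewrite !inE exprMn exprVn => /eqP-> /eqP->.
  by rewrite divff ?mu_neq0.
have sumC : \sum_(z in mu) #|C z| = e * f.
  (* With [V] reduced to 0 the degrees count the elements [x] for which [- x] has the given
     colour. *)
  have := sum_residue_degree [set 0%R]; rewrite cards1 mul1n exchange_big /= => <-.
  apply: eq_bigr => z _; rewrite -sum1_card big_mkcond (reindex_inj oppr_inj) /=.
  by apply: eq_bigr => x _; rewrite residue_degreeE big_set1 inE sub0r; case: eqP.
have mule := card_unity_set_le e_gt0.
have sumle : \sum_(z in mu) #|C z| <= #|mu| * f by rewrite -sum_nat_const; apply: leq_sum.
have mue : #|mu| = e.
  by apply/eqP; rewrite eqn_leq mule -(leq_pmul2r f_gt0) -sumC sumle.
split=> // z zmu; apply/eqP; rewrite eqn_leq Cle //= leqNgt; apply/negP => lt.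
have : \sum_(z in mu) #|C z| < #|mu| * f.
  rewrite -sum_nat_const (bigD1 z) //= [ltnRHS](bigD1 z) //= -addSn.
  by apply: leq_add => //; apply: leq_sum => w /andP[/Cle].
by rewrite mue sumC ltnn.
Qed.

Lemma exists_primitive_root : exists w : F, (e.-primitive_root w)%R.
Proof.
have [mue _] := card_mu_class.
have : has e.-primitive_root%R (enum mu).
  apply: has_prim_root; rewrite ?enum_uniq -?cardE ?mue //.
  by apply/allP => z; rewrite mem_enum inE => /eqP ze; apply/unity_rootP.
by case/hasP=> w _; exists w.
Qed.

(** The candidate sets are the colour classes of the [c i], of size [f], so the point is
    [threshold r n.-1 <= f] for [r] the square root of [#|F|] rounded up. By [threshold_le] and
    [4 * n ^ 2 <= e], [e] times the threshold is at most [e ^ n * (1 + 5 * r / 4)], whereas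
    [e * f >= (r - 1) ^ 2] and [e ^ n <= 2 * (r - 1) / 3]. *)
Lemma exists_configuration (n : nat) (c : nat -> F) (z : nat -> nat -> F) :
    2 < n -> 4 * n ^ 2 <= e -> boundU e n ^ 2 < #|F| ->
    (forall i, c i \in mu) -> (forall i j, z i j \in mu) ->
  exists x : nat -> F, (forall i, i < n -> (x i ^+ f)%R = c i) /\
    forall i j, i < j < n -> ((x i - x j) ^+ f)%R = z i j.
Proof.
move=> n_gt2 ne UF cmu zmu.
have bern k : e ^ k <= (e - 1) ^ k + k * e ^ k.-1.
  elim: k => // k IHk; rewrite expnS.
  apply: leq_trans (leq_mul (leqnn e) IHk) _; rewrite [k.+1.-1]/=.
  have : (e - 1) ^ k <= e ^ k by case: (k) => // k'; rewrite leq_exp2r // leq_subr.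
  have -> : e * ((e - 1) ^ k + k * e ^ k.-1) = e * (e - 1) ^ k + k * e ^ k.
    by case: (k) => [|k']; [rewrite !mul0n !addn0 | rewrite [e ^ k'.+1]expnS /=; lia].
  by rewrite expnS; nia.
(* The term [h = n] of [boundU] suffices: [n - 1 >= 2], and Bernoulli's inequality with [4 * n <= e]
   gives [(e - 1) ^ n >= 3 / 4 * e ^ n]. *)
have U_ge : 3 * e ^ n <= 2 * boundU e n.
  have : (e - 1) ^ n * (n - 1) <= boundU e n.
    rewrite /boundU big_nat_recr /=; last by lia.
    by rewrite binn mul1n leq_addl.
  have := bern n; rewrite -[in X in X <= _](prednK (n := n)) ?expnS; last by lia.
  have : 4 * n <= e by apply: leq_trans ne; nia.
  have -> : e ^ n = e * e ^ n.-1 by rewrite -expnS prednK //; lia.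
  by nia.
have exr : exists r, #|F| <= r ^ 2 by exists #|F|; rewrite -mulnn leq_pmulr // cardF.
have [r Fr rmin] := ex_minnP exr.
have Ur : boundU e n < r by rewrite -ltn_sqr (leq_trans UF).
have rF : (r - 1) ^ 2 <= e * f.
  rewrite -ltnS -cardF ltnNge; apply/negP => /rmin; lia.
have thr : threshold r n.-1 <= f.
  rewrite -(leq_pmul2l e_gt0); apply: leq_trans rF.
  apply: leq_trans (leq_mul (leqnn e) (threshold_le r n.-1)) _.
  have -> : e * (e ^ n.-1 + r * e ^ n.-1 + r * n.-1 ^ 2 * e ^ n.-1.-1) =
     e ^ n + r * e ^ n + r * n.-1 ^ 2 * e ^ n.-1.
    have -> : e ^ n = e * e ^ n.-1 by rewrite -expnS prednK //; lia.
    have -> : e ^ n.-1 = e * e ^ n.-1.-1 by rewrite -expnS prednK //; lia.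
    by lia.
  have h1 : 4 * n.-1 ^ 2 * e ^ n.-1 <= e ^ n.
    have -> : e ^ n = e * e ^ n.-1 by rewrite -expnS prednK //; lia.
    by rewrite leq_mul2r; apply/orP; right; apply: leq_trans ne; nia.
  have h2 : 4 * (r * n.-1 ^ 2 * e ^ n.-1) <= r * e ^ n.
    by apply: leq_trans (leq_mul (leqnn r) h1); lia.
  have h3 : 10 < r.
    have : e ^ 1 <= e ^ n by rewrite leq_pexp2l //; lia.
    by rewrite expn1; nia.
  set A := e ^ n in U_ge h1 h2 *; set D := r * _ * _ in h2 *.
  clearbody A D; clear -U_ge h2 h3 Ur.
  have : 3 * A <= 2 * (r - 1) by lia.
  by nia.
have [_ cardC] := card_mu_class.
have [||x [xc xz]] := @greedy_configuration r n.-1 (fun i => [set x | x ^+ f == c i]%R) z Fr.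
- by move=> i _; rewrite cardC.
- exact: zmu.
exists x; split=> [i ni | i j /andP[ij jn]].
  by have := xc i; rewrite inE -ltnS prednK; [move=> /(_ ni)/eqP | lia].
by apply: xz; rewrite ij /=; lia.
Qed.

End PowerResidues.

(** * Base block patterns and their realisation in one field *)

Section Patterns.

Variables (gT : finGroupType) (I : finType) (n : nat).
Variables (kappa : I -> nat) (a : I -> 'I_n -> gT).

Definition base_points : {set I * 'I_n} := [set p : I * 'I_n | p.2 < kappa p.1].

Definition base_pairs (h : gT) : {set I * ('I_n * 'I_n)} :=
  [set p : I * ('I_n * 'I_n) | [&& p.2.1 != p.2.2, p.2.1 < kappa p.1,
      p.2.2 < kappa p.1 & (a p.1 p.2.1 * (a p.1 p.2.2)^-1)%g == h]].

Definition increasing_pairs (h : gT) : {set I * ('I_n * 'I_n)} :=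
  [set p in base_pairs h | p.2.1 < p.2.2].

(** The points, and for each [h] the pairs with quotient [h], get nonzero elements of distinct
    colours. Where their number equals the number of colours, these elements represent every coset
    of the [e]-th powers exactly once. *)
Definition field_system (F : finFieldType) (f : nat) (x : I -> 'I_n -> F) : Prop :=
  [/\ forall p, p \in base_points -> x p.1 p.2 != 0%R,
      {in base_points &, injective (fun p => x p.1 p.2 ^+ f)%R},
      forall h p, p \in base_pairs h -> (x p.1 p.2.1 - x p.1 p.2.2 != 0)%R
    & forall h, {in base_pairs h &,
        injective (fun p => (x p.1 p.2.1 - x p.1 p.2.2) ^+ f)%R}].

Definition swap_pair (p : I * ('I_n * 'I_n)) := (p.1, (p.2.2, p.2.1)).

Lemma swap_pairK : involutive swap_pair.
Proof. by case=> b [i j]. Qed.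

Lemma base_pairs_swap h p : (swap_pair p \in base_pairs h) = (p \in base_pairs h^-1%g).
Proof.
rewrite !inE /= [in LHS]eq_sym -(inj_eq invg_inj) invMg invgK.
by do ![case: (_ < _) => //=]; rewrite !andbF.
Qed.

Lemma base_pairs_split h p : p \in base_pairs h ->
  p \in increasing_pairs h \/ swap_pair p \in increasing_pairs h^-1%g.
Proof.
move=> pD; have sD : swap_pair p \in base_pairs h^-1%g by rewrite base_pairs_swap invgK.
move: (pD); rewrite inE => /andP[]; rewrite neq_ltn => /orP[] lt _; [left | right].
  by rewrite inE pD.
by rewrite inE sD.
Qed.

(** Swapping a pair inverts its quotient, so the decreasing pairs for [h] correspond to the
    increasing pairs for [h^-1]. *)
Lemma card_base_pairs h :
  #|base_pairs h| = #|increasing_pairs h| + #|increasing_pairs h^-1%g|.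
Proof.
rewrite -(cardsID [set p : I * ('I_n * 'I_n) | p.2.1 < p.2.2] (base_pairs h)); congr (_ + _).
  by apply: eq_card => p; rewrite !inE.
rewrite -(card_imset _ (inv_inj swap_pairK)).
apply: eq_card => p; rewrite -{1}(swap_pairK p) mem_imset; last exact: inv_inj swap_pairK.
rewrite inE base_pairs_swap !inE /= -leqNgt andbC [in RHS]andbC.
case: eqVneq => //= pp; first by rewrite andbF.
rewrite andbC; congr (_ && _).
by move: pp; rewrite -(inj_eq val_inj) /=; case: ltngtP.
Qed.

(* Increasing pairs with the same quotient get distinct colours among the first
   half of the powers of [w]; as [(-1) ^+ f = -1 = w ^+ e./2], the reversed pairs
   then use the second half. *)
Lemma exists_field_system (F : finFieldType) (e f : nat) :
    #|F| = (e * f).+1 -> 0 < e -> odd f -> ~~ odd e ->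
    2 < n -> 4 * n ^ 2 <= e -> boundU e n ^ 2 < #|F| ->
    (forall b, kappa b <= n) -> #|base_points| <= e ->
    (forall h, #|increasing_pairs h| <= e./2) ->
  exists x, field_system f (x : I -> 'I_n -> F).
Proof.
move=> cF e_gt0 f_odd e_even n_gt2 ne UF kn cP cD.
have f_gt0 : 0 < f by case: (f) f_odd.
have [w wprim] := exists_primitive_root cF e_gt0 f_gt0.
have wmu k : (w ^+ k)%R \in [set z | (z ^+ e == 1)%R].
  by rewrite inE exprAC (prim_expr_order wprim) expr1n.
have e2 : e./2 + e./2 = e by rewrite addnn -[RHS]odd_double_half (negbTE e_even).
have wN : (w ^+ e./2 = -1)%R.
  have : ((w ^+ e./2) ^+ 2 == 1)%R.
    by rewrite -exprM muln2 -addnn e2 (prim_expr_order wprim).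
  rewrite sqrf_eq1 => /orP[|/eqP //]; rewrite -(prim_order_dvd wprim) => /dvdn_leq.
  by lia.
have wS : ((-1) ^+ f = -1 :> F)%R by rewrite -signr_odd f_odd expr1.
pose quot b (i j : 'I_n) := (a b i * (a b j)^-1)%g.
(* Colours are powers of [w] whose exponents are ranks in enumerations of the points and of the
   increasing pairs with the same quotient. *)
pose pt b i := index (b, i) (enum base_points).
pose pr b i j := index (b, (i, j)) (enum (increasing_pairs (quot b i j))).
(* Distinct blocks interact only through the prescribed colours, so each block is embedded on its
   own. *)
have conf b : exists x : 'I_n -> F, (forall i, (x i ^+ f = w ^+ pt b i)%R) /\
    forall i j : 'I_n, i < j -> ((x i - x j) ^+ f = w ^+ pr b i j)%R.
  (* The exponent 0 outside the range of ['I_n] is a mere default. *)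
  pose c i : F := (w ^+ (if insub i is Some i' then pt b i' else 0))%R.
  pose z i j : F := (w ^+ (if insub i is Some i' then
    if insub j is Some j' then pr b i' j' else 0 else 0))%R.
  have [||y [yc yz]] := @exists_configuration F e f cF e_gt0 f_gt0 n c z n_gt2 ne UF.
  - by move=> i; apply: wmu.
  - by move=> i j; apply: wmu.
  exists (fun i => y i); split=> [i | i j ij].
    by rewrite yc // /c valK.
  by rewrite yz ?ij ?ltn_ord // /z !valK.
have [x xP] := fin_all_exists conf.
exists x.
have wpow i j : i < e -> j < e -> (w ^+ i == w ^+ j)%R = (i == j).
  by move=> ie je; rewrite (eq_prim_root_expr wprim) !modn_small.
have pt_lt p : p \in base_points -> pt p.1 p.2 < e.
  case: p => b i pP; apply: leq_trans cP.
  by rewrite cardE index_mem mem_enum.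
have pr_lt h p : p \in increasing_pairs h -> pr p.1 p.2.1 p.2.2 < e./2.
  case: p => b [i j] pD; apply: leq_trans (cD h).
  rewrite cardE /pr; have -> : quot b i j = h.
    by move: pD; rewrite !inE => /andP[/and4P[_ _ _ /eqP]].
  by rewrite index_mem mem_enum.
have incr h p : p \in increasing_pairs h ->
    ((x p.1 p.2.1 - x p.1 p.2.2) ^+ f = w ^+ pr p.1 p.2.1 p.2.2)%R.
  by rewrite inE => /andP[_]; have [_] := xP p.1; apply.
have decr h p : swap_pair p \in increasing_pairs h ->
    ((x p.1 p.2.1 - x p.1 p.2.2) ^+ f = w ^+ (e./2 + pr p.1 p.2.2 p.2.1))%R.
  by move=> /incr /= E; rewrite -opprB exprNn wS E exprD wN.
have pr_lt' h p : swap_pair p \in increasing_pairs h -> pr p.1 p.2.2 p.2.1 < e./2.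
  by move/pr_lt.
have pr_inj h p q : p \in increasing_pairs h -> q \in increasing_pairs h ->
    pr p.1 p.2.1 p.2.2 = pr q.1 q.2.1 q.2.2 -> p = q.
  case: p q => b [i j] [b' [i' j']] pD qD; rewrite /pr.
  have -> : quot b i j = h by move: pD; rewrite !inE => /andP[/and4P[_ _ _ /eqP]].
  have -> : quot b' i' j' = h by move: qD; rewrite !inE => /andP[/and4P[_ _ _ /eqP]].
  by apply: (index_inj (b, (i, j))); rewrite mem_enum.
have pow_neq0 (y : F) k : (y ^+ f = w ^+ k -> y != 0)%R.
  by apply: contra_eq_neq => ->; rewrite expr0n eqn0Ngt f_gt0 eq_sym (mu_neq0 e_gt0 (wmu k)).
split.
- by move=> [b i] pP; have [E _] := xP b; apply: pow_neq0 (E i).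
- move=> [b i] [b' i'] pP qP; rewrite /= !(proj1 (xP _)) => /eqP.
  rewrite wpow ?(pt_lt (_, _)) // => /eqP.
  by apply: (index_inj (b, i)); rewrite mem_enum.
- by move=> h p /base_pairs_split[/incr|/decr] /pow_neq0.
- move=> h p q /base_pairs_split[pD|pD] /base_pairs_split[qD|qD].
  + rewrite (incr _ _ pD) (incr _ _ qD) => /eqP.
    have := pr_lt _ _ pD; have := pr_lt _ _ qD => l1 l2.
    by rewrite wpow; [move/eqP; apply: (pr_inj h) | lia | lia].
  + rewrite (incr _ _ pD) (decr _ _ qD) => /eqP.
    have := pr_lt _ _ pD; have := pr_lt' _ _ qD => l1 l2.
    by rewrite wpow; [move/eqP => E; exfalso; lia | lia | lia].
  + rewrite (decr _ _ pD) (incr _ _ qD) => /eqP.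
    have := pr_lt' _ _ pD; have := pr_lt _ _ qD => l1 l2.
    by rewrite wpow; [move/eqP => E; exfalso; lia | lia | lia].
  + rewrite (decr _ _ pD) (decr _ _ qD) => /eqP.
    have := pr_lt' _ _ pD; have := pr_lt' _ _ qD => l1 l2.
    rewrite wpow; [move/eqP/addnI => E | lia | lia].
    by apply: (inv_inj swap_pairK); apply: (pr_inj h^-1%g).
Qed.

End Patterns.

(** * Counting points and differences in the pattern of all maps *)

Section AllFunctions.

Variables (gT : finGroupType) (n : nat) (s : seq nat).
Hypothesis s_le : forall k, k \in s -> k <= n.

Local Notation I := ('I_(size s) * {ffun 'I_n -> gT})%type.

Definition pattern_size (b : I) : nat := nth 0 s b.1.

Definition pattern_value (b : I) (i : 'I_n) : gT := b.2 i.

Lemma pattern_size_in b : pattern_size b \in s.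
Proof. exact: mem_nth. Qed.

Lemma card_pattern_points :
  #|base_points n pattern_size| = #|gT| ^ n * \sum_(k <- s) k.
Proof.
transitivity (\sum_(t < size s) \sum_(phi : {ffun 'I_n -> gT}) \sum_(i < n)
    if ((t, phi), i) \in base_points n pattern_size then 1 else 0).
  rewrite pair_bigA pair_bigA -sum1_card big_mkcond /=.
  by apply: eq_bigr => -[[t phi] i].
rewrite (big_nth 0) big_mkord big_distrr /=; apply: eq_bigr => t _.
have -> : #|gT| ^ n = #|{ffun 'I_n -> gT}| by rewrite card_ffun card_ord.
rewrite -sum_nat_const; apply: eq_bigr => phi _.
have le : nth 0 s t <= n by apply/s_le/mem_nth.
under eq_bigr do rewrite inE /pattern_size /=.
by rewrite -big_mkcond /= (big_ord_narrow le) sum1_card card_ord.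
Qed.

(** Multiplying the value at [i] by [h2 * h1^-1] on the left embeds the maps with quotient [h1] into
    those with quotient [h2]; hence all quotients occur equally often. *)
Lemma card_ffun_quotient (i j : 'I_n) (h : gT) : i != j ->
  #|[set phi : {ffun 'I_n -> gT} | (phi i * (phi j)^-1)%g == h]| * #|gT| = #|gT| ^ n.
Proof.
move=> ij; pose A h := [set phi : {ffun 'I_n -> gT} | (phi i * (phi j)^-1)%g == h].
have Ale h1 h2 : #|A h1| <= #|A h2|.
  pose T (phi : {ffun 'I_n -> gT}) :=
    [ffun k => if k == i then (h2 * h1^-1 * phi k)%g else phi k].
  have T_inj : injective T.
    move=> phi psi /ffunP E; apply/ffunP => k; have := E k; rewrite !ffunE.
    by case: ifP => // _ /mulgI.
  rewrite -(card_imset _ T_inj); apply/subset_leq_card/subsetP => _ /imsetP[phi + ->].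
  rewrite !inE !ffunE eqxx [j == i]eq_sym (negbTE ij) => /eqP E.
  by rewrite -mulgA E mulgKV.
have -> : #|gT| ^ n = #|{ffun 'I_n -> gT}| by rewrite card_ffun card_ord.
rewrite -[RHS]sum1_card.
rewrite (partition_big (fun phi : {ffun 'I_n -> gT} => phi i * (phi j)^-1)%g predT) //=.
rewrite mulnC -sum_nat_const; apply: eq_bigr => h' _.
by rewrite sum1dep_card; apply/eqP; rewrite eqn_leq !Ale.
Qed.

(** A block size [k] offers [k * (k - 1) / 2] increasing pairs of positions, and each has quotient
    [h] for a fraction [1 / #|gT|] of the maps. *)
Lemma card_pattern_pairs h :
  #|increasing_pairs pattern_size pattern_value h| * 2 * #|gT| =
  #|gT| ^ n * \sum_(k <- s) k * (k - 1).
Proof.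
set D := increasing_pairs _ _ h.
have -> : #|D| = \sum_(t < size s) \sum_(phi : {ffun 'I_n -> gT}) \sum_(ij : 'I_n * 'I_n)
    if ((t, phi), ij) \in D then 1 else 0.
  rewrite pair_bigA pair_bigA -sum1_card big_mkcond /=.
  by apply: eq_bigr => -[[t phi] ij].
rewrite (big_nth 0) big_mkord big_distrr !big_distrl /=; apply: eq_bigr => t _.
have le : nth 0 s t <= n by apply/s_le/mem_nth.
rewrite exchange_big /=.
have E (ij : 'I_n * 'I_n) : \sum_phi (if ((t, phi), ij) \in D then 1 else 0) * #|gT| =
    if (ij.1 < ij.2) && (ij.2 < nth 0 s t) then #|gT| ^ n else 0.
  case: ij => i j /=; case: ifP => [/andP[ij jk] | nij].
    have inj : i != j by rewrite neq_ltn ij.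
    rewrite -(card_ffun_quotient h inj) -sum1_card -big_distrl; congr (_ * _).
    rewrite [RHS]big_mkcond /=; apply: eq_bigr => phi _.
    by rewrite !inE /= inj (ltn_trans ij jk) jk ij andbT.
  rewrite big1 // => phi _; case: ifP; rewrite // !inE /pattern_size /=.
  by move/andP=> [/and4P[_ _ jk _] ij]; rewrite ij jk in nij.
rewrite -mulnA [2 * _]mulnC mulnA big_distrl /=.
under eq_bigr do rewrite big_distrl E.
rewrite -(pair_bigA _ (fun i j : 'I_n => if (i < j) && (j < nth 0 s t) then #|gT| ^ n else 0)) /=.
rewrite exchange_big /=.
have E2 (j : 'I_n) : \sum_(i < n) (if (i < j) && (j < nth 0 s t) then #|gT| ^ n else 0) =
    if j < nth 0 s t then j * #|gT| ^ n else 0.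
  case: ifP => jk; last by rewrite big1 // => i _; rewrite andbF.
  under eq_bigr do rewrite andbT.
  by rewrite -big_mkcond /= (big_ord_narrow (ltnW (ltn_ord j))) sum_nat_const card_ord.
under eq_bigr do rewrite E2.
have tri k : 2 * \sum_(i < k) i = k * (k - 1).
  elim: k => [|k IHk]; first by rewrite big_ord0.
  by rewrite big_ord_recr mulnDr IHk /=; nia.
rewrite -big_mkcond /= (big_ord_narrow le) -big_distrl /=.
by rewrite -tri mulnC mulnA mulnC.
Qed.

Lemma card_balanced_pairs h :
    \sum_(k <- s) k * (k - 1) = #|gT| * \sum_(k <- s) k ->
  #|increasing_pairs pattern_size pattern_value h| * 2 = #|gT| ^ n * \sum_(k <- s) k.
Proof.
move=> s_eq; have g_gt0 : 0 < #|gT| by rewrite -cardsT cardG_gt0.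
apply/eqP; rewrite -(eqn_pmul2r g_gt0) card_pattern_pairs s_eq.
by rewrite -mulnA [X in _ == _ * X]mulnC.
Qed.

End AllFunctions.

(** * Extreme elements of [K] and balanced lists of block sizes *)

Lemma fset_minP (K : {fset nat}) : 0 < #|` K| ->
  fset_min K \in K /\ forall k, k \in K -> fset_min K <= k.
Proof.
move=> K_gt0; have [m0 m0K] : exists m, m \in K.
  by apply/fset0Pn; rewrite -cardfs_gt0.
have exP : exists m, m \in K by exists m0.
have [m mK mmin] := ex_minnP exP.
suff -> : fset_min K = m by [].
apply/eqP; rewrite eqn_leq /fset_min; apply/andP; split.
  have mK' : m \in enum_fset K by [].
  elim: (enum_fset K) mK' (fset_max K) => // k s IHs; rewrite inE => + b.
  by rewrite big_cons geq_min => /predU1P[->|/IHs->]; rewrite ?leqnn ?orbT.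
rewrite big_seq; elim/big_ind: _ => [|x y mx my|k kK].
- have mK' : m \in enum_fset K by [].
  by rewrite /fset_max (bigD1_seq m) //= ?fset_uniq // leq_maxl.
- by rewrite leq_min mx.
- exact: mmin.
Qed.

Lemma fset_maxP (K : {fset nat}) k : k \in K -> k <= fset_max K.
Proof.
move=> kK; have kK' : k \in enum_fset K by [].
by rewrite /fset_max (bigD1_seq k) //= ?fset_uniq // leq_maxl.
Qed.

(* [sum k (k - 1) = g * sum k] says that blocks of these sizes, developed
   modulo a group of order [g], have as many differences as points. *)
Lemma exists_block_sizes (K : {fset nat}) (g : nat) :
    0 < g -> (forall k, k \in K -> g <= k) -> (exists2 k, k \in K & g < k) -> g \in K ->
  exists s : seq nat, [/\ forall k, k \in s -> k \in K,
    forall k, k \in K -> k != g -> k \in s,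
    \sum_(k <- s) k * (k - 1) = g * \sum_(k <- s) k & 0 < \sum_(k <- s) k].
Proof.
move=> g_gt0 gmin [k1 k1K gk1] gK.
pose big := [seq k <- enum_fset K | g < k].
have bigK k : (k \in big) = (g < k) && (k \in K) by rewrite mem_filter.
(* A size [k > g] has excess [k * (k - 1 - g)] of differences over [g] times points, and the size
   [g] has excess [- g]. So [g] copies of each large [k] are balanced by as many copies of [g] as
   the large excesses sum to. The truncated subtraction is exact as [g < k]. *)
pose s := flatten [seq nseq g k | k <- big] ++ nseq (\sum_(k <- big) k * (k - 1 - g)) g.
have sumE (h : nat -> nat) : \sum_(k <- s) h k =
    g * (\sum_(k <- big) h k) + (\sum_(k <- big) k * (k - 1 - g)) * h g.
  rewrite big_cat big_nseq iter_addn_0 big_flatten big_map /=.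
  congr (_ + _); last by rewrite mulnC.
  by rewrite big_distrr; apply: eq_bigr => k _; rewrite big_nseq iter_addn_0 mulnC.
exists s; split.
- move=> k; rewrite mem_cat => /orP[/flattenP[_ /mapP[k' k'big ->]]|].
    by rewrite mem_nseq => /andP[_ /eqP->]; move: k'big; rewrite bigK => /andP[].
  by rewrite mem_nseq => /andP[_ /eqP->].
- move=> k kK kg; rewrite mem_cat; apply/orP; left; apply/flattenP.
  exists (nseq g k); last by rewrite mem_nseq g_gt0 eqxx.
  apply: map_f; rewrite bigK kK andbT.
  by have := gmin _ kK; rewrite leq_eqVlt eq_sym (negbTE kg).
- rewrite (sumE (fun k => k * (k - 1))) (sumE id) /=.
  have -> : \sum_(k <- big) k * (k - 1) = \sum_(k <- big) k * (k - 1 - g) + g * \sum_(k <- big) k.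
    rewrite big_distrr -big_split /=; apply: eq_big_seq => k.
    rewrite bigK => /andP[gk _].
    by rewrite [g * k]mulnC -mulnDr subnK // subn1 -ltnS prednK // (leq_trans _ gk).
  by move: g_gt0; case: (g) => // g' _; rewrite subn1 /=; lia.
- rewrite (sumE id) /= addn_gt0 muln_gt0 g_gt0 /=.
  have k1big : k1 \in big by rewrite bigK gk1.
  by rewrite (bigD1_seq k1) ?filter_uniq ?fset_uniq //= addn_gt0 (leq_ltn_trans _ gk1).
Qed.

(** * Multipliers in a product of fields *)

Section ProductOfFields.

Variables (N : nat) (F : 'I_N -> finFieldType) (f : 'I_N -> nat).

Local Notation V := {dffun forall i, F i}.

Definition scale (z m : V) : V := [ffun i => (z i * m i)%R].

Definition leading (y : V) (i : 'I_N) : bool :=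
  (y i != 0%R) && [forall j : 'I_N, (j < i) ==> (y j == 0%R)].

(* Only the first nonzero coordinate is constrained, so that the nonzero vectors
   split according to its position, as for iterated field-by-field products. *)
Definition multipliers : {set V} :=
  [set m : V | [exists i, leading m i && (m i ^+ f i == 1)%R]].

Lemma leading_exists (y : V) : y != 1%g -> exists i, leading y i.
Proof.
move=> y1; have [i0 yi0] : exists i, y i != 0%R.
  apply/existsP; apply: contraR y1; rewrite negb_exists => /forallP y0.
  by apply/eqP/ffunP => i; have := y0 i; rewrite negbK ffunE => /eqP.
case: (arg_minnP (fun i : 'I_N => nat_of_ord i) (P := fun i => y i != 0%R) yi0) => i yi imin.
exists i; rewrite /leading yi; apply/forallP => j; apply/implyP => ji.
by apply: contraTT ji => /imin; rewrite -leqNgt.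
Qed.

Lemma leading_unique (y : V) i j : leading y i -> leading y j -> i = j.
Proof.
move=> /andP[yi /forallP li] /andP[yj /forallP lj]; apply/val_inj.
have := li j; have := lj i; rewrite (negbTE yi) (negbTE yj) !implybF -!leqNgt => h1 h2.
by apply/eqP; rewrite eqn_leq h1 h2.
Qed.

Lemma leading_scale (z m : V) i : (forall j, z j != 0%R) ->
  leading (scale z m) i = leading m i.
Proof.
move=> z0; rewrite /leading ffunE mulf_eq0 (negbTE (z0 i)); congr (_ && _).
by apply: eq_forallb => j; rewrite ffunE mulf_eq0 (negbTE (z0 j)).
Qed.

Variable lambda : nat.
Hypotheses (lambda_gt0 : 0 < lambda) (cardF : forall i, #|F i| = (lambda * f i).+1).
Hypothesis f_gt0 : forall i, 0 < f i.

Variables (T : finType) (A : {set T}) (z : T -> V).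
Hypotheses (z0 : forall p i, p \in A -> z p i != 0%R)
  (z_inj : forall i, {in A &, injective (fun p => z p i ^+ f i)%R}).

(** Scaling by a vector without zero coordinates keeps the leading position. There the multiplier
    has colour 1, so the colour of the product determines [p], and then division recovers [m]. *)
Lemma scale_unique p p' m m' : p \in A -> p' \in A ->
    m \in multipliers -> m' \in multipliers ->
  scale (z p) m = scale (z p') m' -> p = p' /\ m = m'.
Proof.
move=> pA p'A; rewrite !inE => /existsP[i /andP[li /eqP mi]] /existsP[i' /andP[li' /eqP mi']] E.
have zz q j : q \in A -> z q j != 0%R by apply: z0.
have ii' : i' = i.
  apply: (@leading_unique (scale (z p) m)); last by rewrite leading_scale // => j; apply: zz.
  by rewrite E leading_scale // => j; apply: zz.
rewrite ii' in mi'.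
have pp' : p = p'.
  apply: (z_inj (i := i)) => //.
  have := congr1 (fun y : V => (y i ^+ f i)%R) E.
  by rewrite !ffunE !exprMn mi mi' !mulr1.
split=> //; apply/ffunP => j; rewrite -pp' in E.
have := congr1 (fun y : V => y j) E; rewrite !ffunE.
exact/mulfI/zz.
Qed.

Hypothesis cardA : #|A| = lambda.

(** The [lambda] distinct colours of [A] at the leading position of [y] exhaust all colours. The [p]
    whose colour agrees with that of [y] there leaves a quotient which is a multiplier. *)
Lemma scale_exists (y : V) : y != 1%g ->
  exists2 p, p \in A & exists2 m, m \in multipliers & scale (z p) m = y.
Proof.
move=> /leading_exists[i li].
have zz q j : q \in A -> z q j != 0%R by apply: z0.
have yi : y i != 0%R by case/andP: li.
have [cmu _] := card_mu_class (cardF i) lambda_gt0 (f_gt0 i).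
set mu := [set _ | _] in cmu.
have im : (fun p => z p i ^+ f i)%R @: A = mu.
  apply/eqP; rewrite eqEcard card_in_imset ?cmu ?cardA ?leqnn ?andbT; last exact: z_inj.
  apply/subsetP => _ /imsetP[p pA ->].
  by apply: (expf_class (cardF i)); apply: zz.
have : (y i ^+ f i)%R \in mu by apply: (expf_class (cardF i)).
rewrite -im => /imsetP[p pA E].
pose m : V := [ffun j => ((z p j)^-1 * y j)%R].
have smy : scale (z p) m = y.
  by apply/ffunP => j; rewrite !ffunE mulrA divff ?mul1r // zz.
exists p => //; exists m => //.
rewrite inE; apply/existsP; exists i.
rewrite -(@leading_scale (z p)) ?smy ?li /=; last by move=> j; apply: zz.
by rewrite ffunE exprMn exprVn E mulVf // expf_neq0 // zz.
Qed.

Lemma one_in_multipliers : 0 < N -> ([ffun=> 1%R] : V) \in multipliers.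
Proof.
move=> N_gt0; rewrite inE; apply/existsP; exists (Ordinal N_gt0).
by rewrite /leading !ffunE oner_eq0 expr1n eqxx andbT; apply/forallP => j.
Qed.

End ProductOfFields.

(** * Developing base blocks into a resolved linear space *)

Section Development.

Variables (gT V : finGroupType) (I : finType) (n : nat).
Variables (kappa : I -> nat) (a : I -> 'I_n -> gT).
Variables (M : finType) (mults : {set M}) (y : I -> 'I_n -> M -> V).

Local Notation points := (base_points n kappa).
Local Notation pairs := (base_pairs kappa a).
Local Notation quot p m := (y p.1 p.2.1 m * (y p.1 p.2.2 m)^-1)%g.

Hypotheses (kappa_gt0 : forall b, 0 < kappa b) (kappa_le : forall b, kappa b <= n).
Hypothesis y_neq1 : forall p m, p \in points -> m \in mults -> y p.1 p.2 m != 1%g.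
Hypothesis y_inj : forall p q m m', p \in points -> q \in points ->
  m \in mults -> m' \in mults -> y p.1 p.2 m = y q.1 q.2 m' -> p = q /\ m = m'.
Hypothesis y_surj : forall u : V, u != 1%g ->
  exists2 p, p \in points & exists2 m, m \in mults & y p.1 p.2 m = u.
Hypothesis quot_neq1 : forall h p m, p \in pairs h -> m \in mults -> quot p m != 1%g.
Hypothesis quot_inj : forall h p q m m', p \in pairs h -> q \in pairs h ->
  m \in mults -> m' \in mults -> quot p m = quot q m' -> p = q /\ m = m'.
Hypothesis quot_surj : forall h (u : V), u != 1%g ->
  exists2 p, p \in pairs h & exists2 m, m \in mults & quot p m = u.

Definition fiber (w : V) : {set gT * V} := [set p : gT * V | p.2 == w].

Definition dev_block (b : I) (m : M) (c : gT * V) : {set gT * V} :=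
  [set (a b j * c.1, y b j m * c.2)%g | j : 'I_n & j < kappa b].

(** All translates of a block by [gT] lie in the same class, so the class depends on the
    [V]-coordinate alone. *)
Definition dev_class (w : V) : {set {set gT * V}} :=
  fiber w |: [set dev_block q.1.1 q.1.2 (q.2, w) | q : I * M * gT & q.1.2 \in mults].

Lemma dev_classP w B : reflect (B = fiber w \/
    exists b m c, m \in mults /\ B = dev_block b m (c, w)) (B \in dev_class w).
Proof.
apply: (iffP setU1P) => [[->|/imsetP[[[b m] c] mM ->]]|[->|[b [m [c [mM ->]]]]]];
  [by left | | by left |].
  by right; exists b, m, c; split=> //; move: mM; rewrite inE.
by right; apply/imsetP; exists (b, m, c); rewrite ?inE.
Qed.

Lemma mem_dev_block b m c p : reflect
  (exists2 j : 'I_n, j < kappa b & p = (a b j * c.1, y b j m * c.2)%g) (p \in dev_block b m c).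
Proof.
by apply: (iffP imsetP) => -[j jk ->]; exists j => //; move: jk; rewrite inE.
Qed.

Lemma translate_fiber (d : gT * V) w : translate_block d (fiber w) = fiber (w * d.2)%g.
Proof.
apply/setP => p; apply/imsetP/idP => [[q qw ->]|pw].
  by move: qw; rewrite !inE /= => /eqP ->.
exists (p * d^-1)%g; last by rewrite /translate mulgKV.
by move: pw; rewrite !inE /= => /eqP->; rewrite mulgK.
Qed.

Lemma translate_dev_block (d : gT * V) b m c :
  translate_block d (dev_block b m c) = dev_block b m (c * d)%g.
Proof.
rewrite /translate_block /dev_block -imset_comp; apply: eq_imset => j /=.
by rewrite /translate; congr (_, _); rewrite /= mulgA.
Qed.

Lemma translate_dev_class (d : gT * V) w :
  translate_class d (dev_class w) = dev_class (w * d.2)%g.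
Proof.
apply/setP => B; apply/imsetP/dev_classP => [[B' /dev_classP[->|[b [m [c [mM ->]]]]] ->]|].
- by left; rewrite translate_fiber.
- by right; exists b, m, (c * d.1)%g; split; rewrite ?translate_dev_block.
case=> [->|[b [m [c [mM ->]]]]].
  by exists (fiber w); [apply/dev_classP; left | rewrite translate_fiber].
exists (dev_block b m (c * d.1^-1, w)%g).
  by apply/dev_classP; right; exists b, m, (c * d.1^-1)%g.
rewrite translate_dev_block; congr dev_block.
by congr (_, _); rewrite /= mulgKV.
Qed.

Lemma dev_block_coord_inj b m (i j : 'I_n) : m \in mults ->
  i < kappa b -> j < kappa b -> y b i m = y b j m -> i = j.
Proof.
move=> mM ik jk E; apply: contra_eq E => ij.
have pD : (b, (i, j)) \in pairs (a b i * (a b j)^-1)%g by rewrite inE /= ij eqxx ik jk.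
by have := quot_neq1 pD mM; apply: contra => /= /eqP ->; rewrite mulgV.
Qed.

Lemma card_dev_block b m c : m \in mults -> #|dev_block b m c| = kappa b.
Proof.
move=> mM; rewrite card_in_imset; last first.
  move=> i j; rewrite !inE => ik jk [_ /mulIg].
  exact: dev_block_coord_inj mM ik jk.
by rewrite -sum1dep_card (big_ord_narrow (kappa_le b)) sum1_card card_ord.
Qed.

Lemma card_fiber w : #|fiber w| = #|gT|.
Proof.
have -> : fiber w = setX [set: gT] [set w] by apply/setP => -[h u]; rewrite !inE.
by rewrite cardsX cards1 muln1 cardsT.
Qed.

(** Off the fiber, the offset of the second coordinate from [w] determines [b], [j] and [m]; the
    first coordinate is then met by the free translation in [gT]. *)
Lemma dev_class_cover w p : exists2 B, B \in dev_class w & p \in B.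
Proof.
case: p => h u; have [uw | uw] := eqVneq u w.
  by exists (fiber w); [apply/dev_classP; left | rewrite inE uw eqxx].
have /y_surj[[b j] bj [m mM E]] : (u * w^-1)%g != 1%g by rewrite -eq_mulgV1.
exists (dev_block b m ((a b j)^-1 * h, w)%g).
  by apply/dev_classP; right; exists b, m, ((a b j)^-1 * h)%g.
apply/mem_dev_block; exists j; first by move: bj; rewrite inE.
by move: E => /= ->; rewrite mulKVg mulgKV.
Qed.

Lemma dev_class_disjoint w B B' p : B \in dev_class w -> B' \in dev_class w ->
  p \in B -> p \in B' -> B = B'.
Proof.
have blk b m c : m \in mults -> p \in dev_block b m (c, w) -> p \in fiber w -> False.
  move=> mM /mem_dev_block[j jk ->]; rewrite inE /= => /eqP E.
  have bj : (b, j) \in points by rewrite inE.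
  have := y_neq1 bj mM; rewrite -(inj_eq (mulIg w)) mul1g /= E.
  by rewrite eqxx.
move=> /dev_classP[->|[b [m [c [mM ->]]]]] /dev_classP[->|[b' [m' [c' [m'M ->]]]]] //.
- by move=> pw /(blk _ _ _ m'M) /(_ pw).
- by move=> /(blk _ _ _ mM) h /h.
- move=> /mem_dev_block[j jk ->] /mem_dev_block[j' j'k [/= E1 /mulIg E2]].
  have bj : (b, j) \in points by rewrite inE.
  have bj' : (b', j') \in points by rewrite inE.
  have [[eb ej] em] := y_inj bj bj' mM m'M E2; subst b' j' m'.
  by rewrite (mulgI _ _ _ E1).
Qed.

Lemma partition_dev_class w : partition (dev_class w) [set: gT * V].
Proof.
apply/and3P; split.
- rewrite eqEsubset subsetT /=; apply/subsetP => p _.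
  by have [B Bw pB] := dev_class_cover w p; apply/bigcupP; exists B.
- apply/trivIsetP => B B' Bw B'w; apply: contraR => /pred0Pn[p /andP[pB pB']].
  by apply/eqP; apply: (dev_class_disjoint Bw B'w pB pB').
- apply/negP => /dev_classP[/esym/setP/(_ (1%g, w))|[b [m [c [mM /esym E]]]]].
    by rewrite !inE eqxx.
  by have := card_dev_block b (c, w) mM; rewrite E cards0 => /esym/eqP; rewrite -leqn0 leqNgt kappa_gt0.
Qed.

(** For distinct second coordinates, the quotient in [gT] selects the set of base pairs, and the
    quotient in [V] then selects a base pair and a multiplier. A translation carries its first point
    to [p], hence its second one to [p']. *)
Lemma dev_pair_exists p p' : p != p' ->
  exists w, exists2 B, B \in dev_class w & (p \in B) && (p' \in B).
Proof.
case: p p' => h u [h' u'] pp'; have [uu' | uu'] := eqVneq u u'.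
  exists u; exists (fiber u); first by apply/dev_classP; left.
  by rewrite !inE uu' eqxx.
have /(quot_surj (h * h'^-1)%g)[[b [i j]] pD [m mM E]] : (u * u'^-1)%g != 1%g by rewrite -eq_mulgV1.
have := pD; rewrite inE => /and4P[/= ij ik jk /eqP Eh].
exists ((y b i m)^-1 * u)%g; exists (dev_block b m ((a b i)^-1 * h, (y b i m)^-1 * u)%g).
  by apply/dev_classP; right; exists b, m, ((a b i)^-1 * h)%g.
have quotE (T : finGroupType) (s t s' t' : T) :
    (s * t^-1 = s' * t'^-1 -> t * (s^-1 * s') = t')%g.
  move=> est; have -> : (s' = s * t^-1 * t')%g by rewrite est mulgKV.
  by rewrite !mulgA mulgKV mulgV mul1g.
apply/andP; split; apply/mem_dev_block; [exists i | exists j] => //=.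
  by rewrite !mulKVg.
by rewrite (quotE _ _ _ _ _ E) (quotE _ _ _ _ _ Eh).
Qed.

(** Identifying the class is enough: inside a class the block is singled out by disjointness. *)
Lemma dev_pair_unique p p' w w' B B' : p != p' ->
    B \in dev_class w -> B' \in dev_class w' ->
    p \in B -> p' \in B -> p \in B' -> p' \in B' -> w = w'.
Proof.
move=> pp'.
have blk b m c : m \in mults -> p \in dev_block b m c -> p' \in dev_block b m c ->
    exists i j, [/\ (b, (i, j)) \in pairs (p.1 * p'.1^-1)%g,
      p = (a b i * c.1, y b i m * c.2)%g & p' = (a b j * c.1, y b j m * c.2)%g].
  move=> mM /mem_dev_block[i ik Ep] /mem_dev_block[j jk Ep'].
  exists i, j; split=> //; rewrite inE /= ik jk Ep Ep' /= invMg mulgA mulgK eqxx.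
  by rewrite !andbT; apply: contra pp' => /eqP ij; rewrite Ep Ep' ij.
have fib b m c w0 : m \in mults -> p \in dev_block b m c -> p' \in dev_block b m c ->
    p \in fiber w0 -> p' \in fiber w0 -> False.
  move=> mM pB p'B; have [i [j [pD Ep Ep']]] := blk _ _ _ mM pB p'B.
  rewrite !inE => /eqP <- /eqP; rewrite Ep Ep' /= => /mulIg E.
  by have := quot_neq1 pD mM; rewrite /= E mulgV eqxx.
move=> /dev_classP[->|[b [m [c [mM ->]]]]] /dev_classP[->|[b' [m' [c' [m'M ->]]]]].
- by rewrite !inE => /eqP <- _ /eqP <-.
- by move=> pf p'f pB p'B; case: (fib _ _ _ _ m'M pB p'B pf p'f).
- by move=> pB p'B pf p'f; case: (fib _ _ _ _ mM pB p'B pf p'f).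
move=> pB p'B pB' p'B'.
have [i [j [pD Ep Ep']]] := blk _ _ _ mM pB p'B.
have [i' [j' [qD Eq Eq']]] := blk _ _ _ m'M pB' p'B'.
have quE (s t r s' t' r' : V) : (s * r = s' * r' -> t * r = t' * r' ->
    s * t^-1 = s' * t'^-1)%g.
  move=> e1 e2; have -> : s = (s' * r' * r^-1)%g by rewrite -e1 mulgK.
  have -> : t = (t' * r' * r^-1)%g by rewrite -e2 mulgK.
  by rewrite !invMg !invgK !mulgA mulgKV mulgK.
have E1 : (y b i m * w = y b' i' m' * w')%g by move: Ep; rewrite Eq => -[_ ->].
have E2 : (y b j m * w = y b' j' m' * w')%g by move: Ep'; rewrite Eq' => -[_ ->].
have [[eb ei ej] em] := quot_inj pD qD mM m'M (quE _ _ _ _ _ _ E1 E2).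
by subst b' i' j' m'; apply: (mulgI _ _ _ E1).
Qed.

Definition dev_classes : seq {set {set gT * V}} := [seq dev_class w | w <- enum V].

Definition dev_blocks : seq {set gT * V} :=
  flatten [seq enum (mem P) | P : {set {set gT * V}} <- dev_classes].

Lemma mem_dev_blocks B : reflect (exists w, B \in dev_class w) (B \in dev_blocks).
Proof.
apply: (iffP flatten_mapP) => [[P /mapP[w _ ->]]|[w Bw]].
  by rewrite mem_enum; exists w.
by exists (dev_class w); [apply: map_f; rewrite mem_enum | rewrite mem_enum].
Qed.

Lemma count_dev_blocks (Q : pred {set gT * V}) :
  count Q dev_blocks = \sum_(w : V) count Q (enum (dev_class w)).
Proof. by rewrite count_flatten sumnE -!map_comp big_map /= -big_enum. Qed.

Lemma harmonious_dev_blocks : harmonious dev_blocks.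
Proof.
exists dev_classes; split.
- split=> [P /mapP[w _ ->]|]; first exact: partition_dev_class.
  exact: perm_refl.
- move=> d; have mulb : bijective (fun w : V => w * d.2)%g.
    by exists (fun w => w * d.2^-1)%g => w; rewrite ?mulgK ?mulgKV.
  split.
    (* Multiplicities are compared class by class, after reindexing the classes by the translation
       of [V]. *)
    apply/seq.permP => Q; rewrite count_map count_dev_blocks.
    rewrite [RHS]count_dev_blocks [RHS](reindex_inj (bij_inj mulb)) /=.
    apply: eq_bigr => w _; rewrite -count_map.
    suff /seq.permP E : perm_eq [seq translate_block d B | B <- enum (dev_class w)]
        (enum (dev_class (w * d.2)%g)) by rewrite E.
    have T_inj : injective (translate_block d : {set gT * V} -> _).
      by apply: imset_inj => p q; apply: mulIg.
    rewrite -translate_dev_class; apply: uniq_perm; rewrite ?enum_uniq ?map_inj_uniq ?enum_uniq //.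
    move=> B; rewrite [RHS]mem_enum; apply/mapP/imsetP => -[B' B'w ->]; exists B' => //.
      by rewrite mem_enum in B'w.
    by rewrite mem_enum.
  have -> : [seq translate_class d P | P <- dev_classes] =
      [seq dev_class w | w <- [seq (w * d.2)%g | w <- enum V]].
    by rewrite -!map_comp; apply: eq_map => w; apply: translate_dev_class.
  apply/perm_map/uniq_perm; rewrite ?(map_inj_uniq (bij_inj mulb)) ?enum_uniq // => w.
  by rewrite mem_enum; apply/mapP; exists (w * d.2^-1)%g; rewrite ?mem_enum // mulgKV.
- move=> p q; exists (p^-1 * q)%g; split; first by rewrite /translate mulKVg.
  by move=> c <-; rewrite /translate mulKg.
- move=> _ _ /mapP[w _ ->] /mapP[w' _ ->]; exists (1, w^-1 * w')%g.
  by rewrite translate_dev_class /= mulKVg.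
Qed.

Lemma linear_space_dev_blocks (K : {fset nat}) :
    #|gT| \in K -> (forall b, kappa b \in K) ->
    (forall k, k \in K -> k != #|gT| -> exists b, kappa b = k) -> (exists m, m \in mults) ->
  linear_space K (#|gT| * #|V|) dev_blocks.
Proof.
move=> gK kK Kk [m0 m0M]; split.
- by rewrite card_prod.
- move=> B /mem_dev_blocks[w /dev_classP[->|[b [m [c [mM ->]]]]]].
    by rewrite card_fiber.
  by rewrite card_dev_block.
- move=> k /Kk; have [-> _ | _ /(_ isT)[b <-]] := eqVneq k #|gT|.
    exists (fiber 1%g); last exact: card_fiber.
    by apply/mem_dev_blocks; exists 1%g; apply/dev_classP; left.
  exists (dev_block b m0 (1, 1)%g); last exact: card_dev_block.
  by apply/mem_dev_blocks; exists 1%g; apply/dev_classP; right; exists b, m0, 1%g.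
- move=> p p' pp'; have [w0 [B0 B0w /andP[pB0 p'B0]]] := dev_pair_exists pp'.
  rewrite count_dev_blocks (bigD1 w0) //= big1 ?addn0; last first.
    move=> w ww0; rewrite (eq_in_count (a2 := pred0)) ?count_pred0 // => B.
    rewrite mem_enum /= => Bw; apply: contraNF ww0 => /andP[pB p'B].
    by apply/eqP; apply: (dev_pair_unique pp' Bw B0w pB p'B pB0 p'B0).
  rewrite (eq_in_count (a2 := pred1 B0)); last first.
    move=> B; rewrite mem_enum /= => Bw; apply/andP/eqP => [[pB _]|-> //].
    exact: (dev_class_disjoint Bw B0w pB pB0).
  by rewrite count_uniq_mem ?enum_uniq // mem_enum B0w.
Qed.

End Development.

(** * From field systems in all components to a harmonious space *)

Section BalancedPattern.

Variables (gT : finGroupType) (n : nat) (s : seq nat).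

Local Notation psize := (@pattern_size gT n s).
Local Notation pvalue := (@pattern_value gT n s).

Lemma exists_harmonious_space (K : {fset nat}) (N : nat) (F : 'I_N -> finFieldType) (f : 'I_N -> nat) :
    (forall k, k \in K -> 0 < k) -> #|gT| \in K -> (forall k, k \in s -> k \in K) ->
    (forall k, k \in K -> k != #|gT| -> k \in s) -> (forall k, k \in s -> k <= n) ->
    \sum_(k <- s) k * (k - 1) = #|gT| * \sum_(k <- s) k -> 0 < \sum_(k <- s) k ->
    0 < N -> (forall i, #|F i| = (#|gT| ^ n * (\sum_(k <- s) k) * f i).+1) ->
    (forall i, 0 < f i) ->
    (forall i, exists x : _ -> 'I_n -> F i,
       field_system psize pvalue (f i) x) ->
  exists blocks : seq {set gT * {dffun forall i, F i}},
    linear_space K (#|gT| * #|{dffun forall i, F i}|) blocks /\ harmonious blocks.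
Proof.
move=> Kpos gK sK Ks s_le s_eq s_gt0 N_gt0 cardF f_gt0 /fin_all_exists[x xP].
set lambda := #|gT| ^ n * _ in cardF.
have g_gt0 : 0 < #|gT| by apply: Kpos.
have lambda_gt0 : 0 < lambda by rewrite muln_gt0 expn_gt0 g_gt0.
have cardP : #|base_points n psize| = lambda by apply: card_pattern_points.
have cardI h : #|increasing_pairs psize pvalue h| * 2 = lambda.
  exact: card_balanced_pairs.
have cardD h : #|base_pairs psize pvalue h| = lambda.
  have := cardI h; have := cardI h^-1%g; rewrite card_base_pairs; lia.
pose V := {dffun forall i, F i}.
pose z (p : _ * 'I_n) : V := [ffun i => x i p.1 p.2].
pose d (p : _ * ('I_n * 'I_n)) : V := [ffun i => (x i p.1 p.2.1 - x i p.1 p.2.2)%R].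
have scale_neq1 (w m : V) : (forall i, w i != 0%R) -> m \in multipliers F f -> scale w m != 1%g.
  move=> w0; rewrite inE => /existsP[i /andP[/andP[mi _] _]].
  apply/eqP => /(congr1 (fun u : V => u i)); rewrite !ffunE => /eqP.
  by rewrite mulf_eq0 (negbTE (w0 i)) (negbTE mi).
have z0 p i : p \in base_points n psize -> z p i != 0%R.
  by case: (xP i) => x0 _ _ _ pP; rewrite ffunE x0.
have z_inj i : {in base_points n psize &, injective (fun p => z p i ^+ f i)%R}.
  by case: (xP i) => _ xi _ _ p q pP qP; rewrite !ffunE; apply: xi.
have d0 h p i : p \in base_pairs psize pvalue h -> d p i != 0%R.
  by case: (xP i) => _ _ x0 _ pP; rewrite ffunE (x0 h).
have d_inj h i : {in base_pairs psize pvalue h &,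
    injective (fun p => d p i ^+ f i)%R}.
  by case: (xP i) => _ _ _ xi p q pP qP; rewrite !ffunE; apply: (xi h).
pose y b i (m : V) : V := scale (z (b, i)) m.
(* By distributivity, differences of scaled points are scaled differences, so the results on
   multipliers serve points and pairs alike. *)
have yd (p : _ * ('I_n * 'I_n)) m : (y p.1 p.2.1 m * (y p.1 p.2.2 m)^-1)%g = scale (d p) m.
  by apply/ffunP => i; rewrite !ffunE /= mulrBl.
have yz (p : _ * 'I_n) m : y p.1 p.2 m = scale (z p) m by case: p.
have kappaK b : psize b \in K by apply/sK/pattern_size_in.
have kappa_gt0 b : 0 < psize b by apply: Kpos.
have kappa_le b : psize b <= n by apply/s_le/pattern_size_in.
have y_neq1 p m : p \in base_points n psize -> m \in multipliers F f -> y p.1 p.2 m != 1%g.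
  by move=> pP mM; rewrite yz scale_neq1 // => i; apply: z0.
have y_inj p q m m' : p \in base_points n psize ->
    q \in base_points n psize ->
    m \in multipliers F f -> m' \in multipliers F f -> y p.1 p.2 m = y q.1 q.2 m' -> p = q /\ m = m'.
  by rewrite !yz; apply: scale_unique z0 z_inj _ _ _ _.
have y_surj (u : V) : u != 1%g -> exists2 p, p \in base_points n psize &
    exists2 m, m \in multipliers F f & y p.1 p.2 m = u.
  move=> /(scale_exists lambda_gt0 cardF f_gt0 z0 z_inj cardP)[p pP [m mM E]].
  by exists p => //; exists m; rewrite ?yz.
have q_neq1 h p m : p \in base_pairs psize pvalue h ->
    m \in multipliers F f -> (y p.1 p.2.1 m * (y p.1 p.2.2 m)^-1)%g != 1%g.
  by move=> pP mM; rewrite yd scale_neq1 // => i; apply: (d0 h).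
have q_inj h p q m m' : p \in base_pairs psize pvalue h ->
    q \in base_pairs psize pvalue h ->
    m \in multipliers F f -> m' \in multipliers F f ->
    (y p.1 p.2.1 m * (y p.1 p.2.2 m)^-1)%g = (y q.1 q.2.1 m' * (y q.1 q.2.2 m')^-1)%g ->
    p = q /\ m = m'.
  by rewrite !yd; apply: scale_unique (d0 h) (d_inj h) _ _ _ _.
have q_surj h (u : V) : u != 1%g ->
    exists2 p, p \in base_pairs psize pvalue h &
    exists2 m, m \in multipliers F f & (y p.1 p.2.1 m * (y p.1 p.2.2 m)^-1)%g = u.
  move=> /(scale_exists lambda_gt0 cardF f_gt0 (d0 h) (d_inj h) (cardD h))[p pP [m mM E]].
  by exists p => //; exists m; rewrite ?yd.
exists (dev_blocks psize pvalue (multipliers F f) y); split; last first.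
  exact: harmonious_dev_blocks.
apply: linear_space_dev_blocks => //; last by exists [ffun=> 1%R]; apply: one_in_multipliers.
move=> k kK kg; have ks := Ks k kK kg.
have lt : index k s < size s by rewrite index_mem.
exists (Ordinal lt, [ffun=> 1%g]); exact: nth_index.
Qed.

End BalancedPattern.

(** * The bound [Q], the pattern for a given [K], and the conclusion *)

(** The square root in [Q] is at least [U], so [Q] is at least [(2 * U) ^ 2 / 4 = U ^ 2]. *)
Lemma boundU_sqr_lt (R : realType) (e n q : nat) :
  (boundQ R e n < q%:R)%R -> boundU e n ^ 2 < q.
Proof.
rewrite /boundQ -(ltr_nat R) natrX; apply: le_lt_trans.
have u0 : (0 <= (boundU e n)%:R :> R)%R by apply: ler0n.
have w0 : (0 <= (4 * n * e ^ (n - 1))%:R :> R)%R by apply: ler0n.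
move: (_%:R)%R u0 (_%:R)%R w0 => u u0 w w0.
have : (u <= Num.sqrt (u ^+ 2 + w))%R.
  by rewrite -[leLHS](ger0_norm u0) -sqrtr_sqr ler_sqrt ?addr_ge0 ?sqr_ge0 // lerDl.
move: (Num.sqrt _) => t ut.
have : ((u *+ 2) ^+ 2 <= (u + t) ^+ 2)%R.
  by rewrite ler_sqr ?nnegrE ?mulr2n ?addr_ge0 ?(le_trans u0) ?lerD2l.
by rewrite -mulr_natl exprMn; lra.
Qed.

Lemma prod_components (v : nat) : 0 < v -> \prod_(q <- components v) q = v.
Proof.
by move=> v_gt0; rewrite [RHS]prod_prime_decomp // prime_decompE !big_map.
Qed.

(** The block is [{1, -1}]. As [f] is odd, negation exchanges the two colours, so the two points,
    and likewise the two differences, have different colours. This serves maximal block size 2,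
    where the greedy embedding does not apply. *)
Lemma field_system_pair (I : finType) (gT : finGroupType) (kappa : I -> nat)
    (a : I -> 'I_2 -> gT) (F : finFieldType) (f : nat) :
    #|F| = (2 * f).+1 -> odd f -> #|I| <= 1 ->
  exists x : I -> 'I_2 -> F, field_system kappa a f x.
Proof.
move=> cF f_odd /fintype_le1P I1.
have f_gt0 : 0 < f by case: (f) f_odd.
have [mu2 _] := card_mu_class cF isT f_gt0.
have N1 : (1 != -1 :> F)%R.
  apply/eqP => E; move: mu2; rewrite (_ : [set _ | _] = [set 1%R]) ?cards1 //.
  by apply/setP => u; rewrite !inE sqrf_eq1 -E orbb.
have Nneq (u : F) : u != 0%R -> (u != - u)%R.
  by move=> u0; rewrite -[X in (X != _)%R]mulr1 -mulrN1 (inj_eq (mulfI u0)).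
have sgn (i j : 'I_2) : i != j -> ((-1) ^+ i = - (-1) ^+ j :> F)%R.
  by case: i j => [[|[|//]] ?] [[|[|//]] ?] // _; rewrite ?expr0 ?expr1 ?opprK.
have Nf (u : F) : ((- u) ^+ f = - u ^+ f)%R by rewrite exprNn -signr_odd f_odd expr1 mulN1r.
exists (fun _ i => (-1) ^+ i)%R.
have diff (i j : 'I_2) : i != j -> ((-1) ^+ i - (-1) ^+ j != 0 :> F)%R.
  rewrite eq_sym => ji; rewrite subr_eq0 (sgn _ _ ji).
  by rewrite Nneq // expf_neq0 // oppr_eq0 oner_eq0.
split=> [p _|[b i] [b' j] _ _ /= E|h [b [i j]]|h [b [i j]] [b' [i' j']]].
- by rewrite expf_neq0 // oppr_eq0 oner_eq0.
- rewrite (I1 b b'); congr (_, _); apply: contra_eq E; rewrite eq_sym => ji.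
  by rewrite (sgn _ _ ji) Nf Nneq // !expf_neq0 // oppr_eq0 oner_eq0.
- by rewrite inE => /andP[ij _]; apply: diff.
rewrite !inE /= => /andP[ij _] /andP[ij' _] E; rewrite (I1 b b').
have [ii' | ii'] := eqVneq i i'.
  congr (_, (_, _)) => //; apply/eqP; move: ij ij'; rewrite -ii'.
  by case: i j j' {ii' E} => [[|[|//]] ?] [[|[|//]] ?] [[|[|//]] ?].
have ji : j = i'.
  by apply/eqP; move: ij ii'; case: i j i' {ij' E} => [[|[|//]] ?] [[|[|//]] ?] [[|[|//]] ?].
have ij2 : j' = i.
  by apply/eqP; move: ij' ii'; case: i j' i' {ij E ji} => [[|[|//]] ?] [[|[|//]] ?] [[|[|//]] ?].
move: E; rewrite -ji ij2 -opprB Nf => /eqP.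
by rewrite eq_sym (negbTE (Nneq _ _)) // expf_neq0 // diff // eq_sym.
Qed.

(** From [q = 2 * lambda * t + lambda + 1] one reads off [f = 2 * t + 1]; [1 < lambda] makes
    [lambda + 1] a reduced residue. *)
Lemma eqn_modD1_double (q lambda : nat) : 1 < lambda -> q = lambda + 1 %[mod 2 * lambda] ->
  exists2 f, odd f & q = (lambda * f).+1.
Proof.
move=> l1 E; exists (2 * (q %/ (2 * lambda))).+1; first by rewrite oddS oddM.
have := divn_eq q (2 * lambda); rewrite E modn_small; lia.
Qed.

Lemma exists_block_pattern (K : {fset nat}) (gT : finGroupType) (n k1 : nat) :
    #|gT| \in K -> (forall k, k \in K -> #|gT| <= k) -> (forall k, k \in K -> k <= n) ->
    k1 \in K -> #|gT| < k1 ->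
  exists s : seq nat, [/\ forall k, k \in s -> k \in K,
    forall k, k \in K -> k != #|gT| -> k \in s,
    \sum_(k <- s) k * (k - 1) = #|gT| * \sum_(k <- s) k,
    1 < #|gT| ^ n * \sum_(k <- s) k
  & forall (F : finFieldType) (f : nat), odd f ->
      #|F| = (#|gT| ^ n * (\sum_(k <- s) k) * f).+1 ->
      boundU (#|gT| ^ n * \sum_(k <- s) k) n ^ 2 < #|F| ->
      exists x : _ -> 'I_n -> F,
        field_system (@pattern_size gT n s) (@pattern_value gT n s) f x].
Proof.
move=> gK gmin Kn k1K gk1.
have g_gt0 : 0 < #|gT| by rewrite -cardsT cardG_gt0.
have k1n := Kn _ k1K.
have [n_gt2 | n_le2] := ltnP 2 n; last first.
  (* Here [K] consists of 1 and 2, and one base block of size 2 gives [lambda = 2]. *)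
  have [g1 k12 n2] : [/\ #|gT| = 1, k1 = 2 & n = 2] by split; lia.
  rewrite n2 in Kn *; exists [:: 2]; rewrite !big_seq1 g1; split=> //.
  - by move=> k; rewrite inE => /eqP->; rewrite -k12.
  - move=> k kK /eqP k_neq1; rewrite inE; apply/eqP.
    by have := gmin k kK; have := Kn k kK; rewrite g1; lia.
  - move=> F f f_odd cF _; apply: field_system_pair => //.
    by rewrite card_prod card_ffun card_ord g1 exp1n.
have [s0 [s0K Ks0 s0_eq s0_gt0]] := exists_block_sizes g_gt0 gmin (ex_intro2 _ _ k1 k1K gk1) gK.
(* Repeating the list keeps it balanced and makes [lambda] even and at least [4 * n ^ 2], as the
   embedding requires. *)
pose s := flatten (nseq (4 * n ^ 2) s0).
have sum_s (h : nat -> nat) : \sum_(k <- s) h k = 4 * n ^ 2 * \sum_(k <- s0) h k.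
  by rewrite big_flatten big_nseq iter_addn_0 mulnC.
have mem_s k : (k \in s) = (k \in s0).
  apply/flattenP/idP => [[s' + ks']|ks0]; first by rewrite mem_nseq => /andP[_ /eqP <-].
  by exists s0; rewrite // mem_nseq eqxx muln_gt0 expn_gt0 (ltn_trans _ n_gt2).
have s_eq : \sum_(k <- s) k * (k - 1) = #|gT| * \sum_(k <- s) k.
  by rewrite (sum_s (fun k => k * (k - 1))) (sum_s id) s0_eq mulnCA.
have s_le k : k \in s -> k <= n by rewrite mem_s => /s0K /Kn.
pose lambda := #|gT| ^ n * \sum_(k <- s) k.
have lambda_ge : 4 * n ^ 2 <= lambda.
  by rewrite /lambda (sum_s id) mulnCA leq_pmulr // muln_gt0 expn_gt0 g_gt0.
have lambda_even : ~~ odd lambda by rewrite /lambda (sum_s id) !oddM /= andbF.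
exists s; split=> //.
- by move=> k; rewrite mem_s => /s0K.
- by move=> k kK kg; rewrite mem_s Ks0.
- by apply: leq_trans lambda_ge; nia.
- move=> F f f_odd cF UF; apply: (@exists_field_system _ _ _ _ _ F lambda f) => //.
  + by apply: leq_trans lambda_ge; nia.
  + by move=> b; apply/s_le/pattern_size_in.
  + by rewrite card_pattern_points.
  + by move=> h; rewrite /lambda -(card_balanced_pairs s_le h s_eq) muln2 doubleK.
Qed.

Theorem theorem8p4 (R : realType) (K : {fset nat})
    (hKpos : forall k, k \in K -> 0 < k) (hK : 1 < #|` K|)
    (gT : finGroupType) (hg : #|gT| = fset_min K) :
  exists2 lambda : nat, 0 < lambda &
    forall (v : nat) (F : 'I_(size (components v)) -> finFieldType),
      1 < v ->
      component_fields F ->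
      (forall q, q \in components v ->
         q = lambda + 1 %[mod 2 * lambda] /\
         (boundQ R lambda (fset_max K) < q%:R)%R) ->
      exists blocks : seq {set (gT * prod_additive F)%type},
        linear_space K (fset_min K * v) blocks /\ harmonious blocks.
Proof.
have [gK gmin] := fset_minP (ltnW hK); rewrite -hg in gK gmin *.
have g_gt0 := hKpos _ gK.
have [k1 k1K gk1] : exists2 k, k \in K & #|gT| < k.
  have [k k_ng kK] : exists2 k, k != #|gT| & k \in K.
    have : 0 < #|` (K `\ #|gT|)%fset| by rewrite (cardfsD1 #|gT|) gK in hK.
    by rewrite cardfs_gt0 => /fset0Pn[k]; rewrite in_fsetD1 => /andP[]; exists k.
  by exists k => //; rewrite ltn_neqAle eq_sym k_ng gmin.
set n := fset_max K.
have Kn k : k \in K -> k <= n := @fset_maxP K k.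
have [s [sK Ks s_eq lambda_gt1 sys]] := exists_block_pattern gK gmin Kn k1K gk1.
set lambda := #|gT| ^ n * _ in lambda_gt1 sys.
exists lambda; first exact: ltnW.
move=> v F v_gt1 cardF hq.
have fP i : exists f, odd f && (#|F i| == (lambda * f).+1).
  have [E _] := hq (nth 0 (components v) i) (mem_nth 0 (ltn_ord i)).
  have [f f_odd Ef] := eqn_modD1_double lambda_gt1 E.
  by exists f; rewrite f_odd cardF Ef eqxx.
have [f {}fP] := fin_all_exists fP.
have f_odd i : odd (f i) by case/andP: (fP i).
have cF i : #|F i| = (lambda * f i).+1 by apply/eqP; case/andP: (fP i).
have cardV : #|prod_additive F| = v.
  rewrite card_dep_ffun foldrE big_image /= -[RHS]prod_components ?(ltnW v_gt1) //.
  by rewrite (big_nth 0) big_mkord; apply: eq_bigr => i _; apply: cardF.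
suff: exists blocks : seq {set (gT * prod_additive F)%type},
    linear_space K (#|gT| * #|prod_additive F|) blocks /\ harmonious blocks by rewrite cardV.
apply: (@exists_harmonious_space gT n s K _ F f) => //.
- by move=> k /sK/Kn.
- by have := ltnW lambda_gt1; rewrite muln_gt0 => /andP[].
(* Without components the product [v] would be 1. *)
- rewrite lt0n; apply/eqP => N0; have := prod_components (ltnW v_gt1).
  rewrite (size0nil N0) big_nil => v1.
  by move: v_gt1; rewrite -v1.
- by move=> i; case: (f i) (f_odd i).
- move=> i; apply: sys => //.
  apply: (@boundU_sqr_lt R); rewrite cardF.
  by have [_] := hq (nth 0 (components v) i) (mem_nth 0 (ltn_ord i)).
Qed.
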